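(* Let $(K,\partial)\subseteq(L,\partial)$ be an extension of fields with operators of characteristic $p>0$, where $\partial=(\partial_i)_{i\in I}$, all operators are additive and $\mathrm{Fr}^{m_i}$-linear over the constants with the same natural numbers $m_i$ for $K$ and $L$. Assume that $K$ is strict, i.e. $K^\partial=K^p$. Then $L^\partial$ and $K$ are linearly disjoint over $K^\partial$.
   Context: Let $p$ be a prime. A field with operators $(K,\partial)$ is a field $K$ of characteristic $p$ with a (possibly infinite) tuple of unary functions $\partial=(\partial_i\colon K\to K)_{i\in I}$. The constants are $K^\partial=\{x\in K:\partial_i(x)=0\text{ for all }i\in I\}$. It is assumed throughout that $K^\partial$ is a field, that every $\partial_i$ is additive, and that every $\partial_i$ is ''$\mathrm{Fr}^{m_i}$-linear over the constants'': for each $i\in I$ there is a natural number $m_i\ge 0$ such that $\partial_i(ax)=a^{p^{m_i}}\partial_i(x)$ for all $a\in K^\partial$ and $x\in K$. An extension $(K,\partial)\subseteq(L,\partial)$ is a field extension $K\subseteq L$ where both $K$ and $L$ are fields of characteristic $p$ with tuples of unary functions $(\partial_i)_{i\in I}$ such that the constants $K^\partial$ and $L^\partial$ are fields and every $\partial_i$ is additive and $\mathrm{Fr}^{m_i}$-linear over the constants (of $K$ and of $L$, respectively), indexed by the same set $I$, the operators of $L$ restrict to those of $K$, and the numbers $m_i$ are the same for $K$ and $L$. *)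

(* Defs.v *)
From mathcomp Require Import all_boot all_algebra.
From mathcomp Require Import classical_sets.

Set Implicit Arguments.
Unset Strict Implicit.
Unset Printing Implicit Defensive.

Import GRing.Theory.
Local Open Scope ring_scope.
Local Open Scope classical_set_scope.

Definition constants (I : Type) (K : fieldType) (d : I -> K -> K) : set K :=
  [set x | forall i, d i x = 0].

Definition subfield_set (K : fieldType) (F : set K) : Prop :=
  GRing.divring_closed [in F].

(* A family [d] of unary functions makes [K] a field with operators in
   characteristic [p], with Frobenius exponents [m]. The primality of [p] is
   part of [p \in [pchar K]]. *)
Record operator_field (p : nat) (I : Type) (m : I -> nat) (K : fieldType)
    (d : I -> K -> K) : Prop := OperatorField {
  operator_field_pchar : p \in [pchar K];
  operator_field_constants : subfield_set (constants d);
  operator_field_additive : forall i, {morph d i : x y / x + y};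
  operator_field_linear : forall i (a x : K), constants d a ->
    d i (a * x) = a ^+ (p ^ m i) * d i x
}.

(* An extension of fields is given by its embedding [iota], which need not be
   an inclusion of subsets. *)
Record operator_extension (p : nat) (I : Type) (m : I -> nat)
    (K L : fieldType) (dK : I -> K -> K) (dL : I -> L -> L)
    (iota : {rmorphism K -> L}) : Prop := OperatorExtension {
  operator_extension_base : operator_field p m dK;
  operator_extension_top : operator_field p m dL;
  operator_extension_restrict : forall i x, dL i (iota x) = iota (dK i x)
}.

Definition strict (p : nat) (I : Type) (K : fieldType) (d : I -> K -> K) :
    Prop :=
  constants d = range (fun x : K => x ^+ p).

Definition lin_indep_over (L : fieldType) (F : set L) (n : nat)
    (x : 'I_n -> L) : Prop :=
  forall a : 'I_n -> L, (forall j, F (a j)) ->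
    \sum_(j < n) a j * x j = 0 -> forall j, a j = 0.

(* Meant for subfields [A] and [B] of [L] with a common subfield [F]; the
   notion is then symmetric in [A] and [B]. *)
Definition linearly_disjoint (L : fieldType) (F A B : set L) : Prop :=
  forall (n : nat) (x : 'I_n -> L), (forall j, A (x j)) ->
    lin_indep_over F x -> lin_indep_over B x.

(* Main.v *)
Require Import Defs.
From mathcomp Require Import all_boot all_algebra.
From mathcomp Require Import classical_sets.

(** Why the theorem holds. Elements [x_0, ..., x_n] of the constants of [L]
    that are independent over [F = K^d = K^p] must stay independent over [K].
    As in the classical argument for Wronskians, one normalizes a relation
    [\sum_j k_j x_j = 0] over [K] so that some [k_j0] is [1], and applies
    [d_i]. Since [d_i 1 = 0], this gives the shorter relation
    [\sum_(j <> j0) d_i(k_j) x_j^(p^m_i) = 0]. If it is trivial for all [i],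
    then all [k_j] are constants, so the original relation was over [F], which
    is impossible.

    When [m_i > 0] the shorter relation is not between the [x_j] but between
    their [p^m_i]-th powers, so these too must be known to be independent over
    [K]; strictness and induction on the number of elements give this. By
    induction the [x_j] with [j <> j0] are independent over [K]. By injectivity
    of Frobenius their [p]-th powers are then independent over [K^p]
    ([lin_indep_frobenius]). But [K^p = F], and the [p]-th powers are again
    constants of [L], so the induction hypothesis applies to them and makes
    them independent over [K]; iterating reaches every exponent [p^e]
    ([lin_indep_iter_frobenius]). *)

Set Implicit Arguments.
Unset Strict Implicit.
Unset Printing Implicit Defensive.

Import GRing.Theory.
Local Open Scope ring_scope.
Local Open Scope classical_set_scope.

Lemma lin_indep_over_lift (L : fieldType) (F : set L) (n : nat)
    (x : 'I_n.+1 -> L) (j0 : 'I_n.+1) :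
  F 0 -> lin_indep_over F x -> lin_indep_over F (fun j => x (lift j0 j)).
Proof.
move=> F0 x_indep a Fa a_rel j.
pose b k := if unlift j0 k is Some j' then a j' else 0.
have bE j' : b (lift j0 j') = a j' by rewrite /b liftK.
rewrite -bE; apply: x_indep => [k|].
  by rewrite /b; case: unliftP.
rewrite (bigD1_ord j0) //= {1}/b unlift_none mul0r add0r -[RHS]a_rel.
by apply: eq_bigr => j' _; rewrite bE.
Qed.

(** A relation between the [y_j ^+ p] with coefficients [a_j ^+ p] is the
    [p]-th power of the relation between the [y_j] with coefficients [a_j],
    and Frobenius is injective. *)
Lemma lin_indep_frobenius (p : nat) (K L : fieldType)
    (iota : {rmorphism K -> L}) (n : nat) (y : 'I_n -> L) :
    p \in [pchar L] -> lin_indep_over (range iota) y ->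
  lin_indep_over (iota @` range (fun a : K => a ^+ p)) (fun j => y j ^+ p).
Proof.
move=> pL y_indep a aP a_rel.
have {aP} /fin_all_exists[c cE] j : exists c : K, a j = iota c ^+ p.
  by have [_ [c _ <-] <-] := aP j; exists c; rewrite rmorphXn.
have c_rel : \sum_(j < n) iota (c j) * y j = 0.
  apply: (fmorph_inj (pFrobenius_aut pL)); rewrite rmorph0 -[RHS]a_rel.
  rewrite rmorph_sum; apply: eq_bigr => j _.
  by rewrite /= pFrobenius_autE exprMn cE.
move=> j; rewrite cE (y_indep (fun j => iota (c j))) //.
by rewrite expr0n gtn_eqF // prime_gt0 // (pcharf_prime pL).
Qed.

Lemma subfield_set1 (K : fieldType) (F : set K) : subfield_set F -> F 1.
Proof. by case=> /set_mem. Qed.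

Lemma subfield_set0 (K : fieldType) (F : set K) : subfield_set F -> F 0.
Proof.
by case=> F1 FB _; have := FB _ _ F1 F1; rewrite subrr => /set_mem.
Qed.

Lemma subfield_setX (K : fieldType) (F : set K) (x : K) (n : nat) :
  subfield_set F -> F x -> F (x ^+ n).
Proof.
case=> F1 _ FV /mem_set Fx; apply: set_mem.
elim: n => [|n IHn]; first by rewrite expr0.
rewrite exprSr -[x in _ * x]invrK -[x^-1]div1r.
by apply: (FV) => //; apply: (FV).
Qed.

Section OperatorExtension.

Variables (p : nat) (I : Type) (m : I -> nat) (K L : fieldType).
Variables (dK : I -> K -> K) (dL : I -> L -> L) (iota : {rmorphism K -> L}).
Hypothesis hext : operator_extension p m dK dL iota.

(** Applying an operator to a relation over [K] between constants of [L]
    differentiates the coefficients and twists the constants by Frobenius. *)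
Lemma operator_relation (i : I) (n : nat) (k : 'I_n -> K) (x : 'I_n -> L) :
    (forall j, constants dL (x j)) -> \sum_(j < n) iota (k j) * x j = 0 ->
  \sum_(j < n) iota (dK i (k j)) * x j ^+ (p ^ m i) = 0.
Proof.
move=> xC k_rel; have [_ [_ LF dLD dLM] dLK] := hext.
have dL0 : dL i 0 = 0 by rewrite (subfield_set0 LF i).
rewrite -[RHS]dL0 -[in RHS]k_rel (big_morph (dL i) (dLD i) dL0).
by apply: eq_bigr => j _; rewrite [iota (k j) * _]mulrC dLM // dLK mulrC.
Qed.

(** The hypothesis [IH] is linear disjointness for families of length [n].
    Strictness makes it apply again after each Frobenius twist: the
    coefficients [K^p] provided by [lin_indep_frobenius] are the
    constants of [K]. *)
Lemma lin_indep_iter_frobenius (n : nat) (y : 'I_n -> L) (e : nat) :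
    strict p dK ->
    (forall x : 'I_n -> L, (forall j, constants dL (x j)) ->
       lin_indep_over (iota @` constants dK) x ->
       lin_indep_over (range iota) x) ->
    (forall j, constants dL (y j)) ->
    lin_indep_over (iota @` constants dK) y ->
  lin_indep_over (range iota) (fun j => y j ^+ (p ^ e)).
Proof.
move=> hstrict IH yC y_indep; have [_ [pL LF _ _] _] := hext.
elim: e => [|e IHe].
  by have := IH _ yC y_indep => + a aK; apply => //; rewrite expn0.
apply: IH => [j|]; first exact: (subfield_setX _ LF).
have := lin_indep_frobenius pL IHe; rewrite -hstrict => ye_indep a aF a_rel.
apply: ye_indep => //; rewrite -[RHS]a_rel.
by apply: eq_bigr => j _; rewrite -exprM expnSr.
Qed.

End OperatorExtension.

Theorem lemma2p1 (p : nat) (I : Type) (m : I -> nat) (K L : fieldType)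
    (dK : I -> K -> K) (dL : I -> L -> L) (iota : {rmorphism K -> L})
    (hext : operator_extension p m dK dL iota) (hstrict : strict p dK) :
  linearly_disjoint (iota @` constants dK) (constants dL) (range iota).
Proof.
elim=> [|n IHn] x xC x_indep a aK a_rel j0; first by case: j0.
have [[_ KF _ _] _ _] := hext.
have {aK} /fin_all_exists[c cE] j : exists c : K, iota c = a j.
  by have [c _ <-] := aK j; exists c.
apply/eqP/negPn/negP => a0; have c0 : c j0 != 0.
  by rewrite -(fmorph_eq0 iota) cE.
pose k j := c j / c j0.
have kj0 : k j0 = 1 by rewrite /k divff.
have k_rel : \sum_(j < n.+1) iota (k j) * x j = 0.
  rewrite -[RHS](mulr0 (a j0)^-1) -[in RHS]a_rel mulr_sumr.
  apply: eq_bigr => j _.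
  by rewrite /k fmorph_div !cE mulrAC mulrC mulrA.
have F0 : (iota @` constants dK) 0.
  by exists 0; [exact: subfield_set0 | rewrite rmorph0].
have kC j : constants dK (k j).
  case: (unliftP j0 j) => [j'|] ->; last by rewrite kj0; apply: subfield_set1.
  move=> i; apply: (fmorph_inj iota); rewrite rmorph0.
  have y_indep := lin_indep_iter_frobenius (e := m i) hext hstrict IHn
    (fun j => xC (lift j0 j)) (lin_indep_over_lift F0 x_indep).
  apply: (y_indep (fun j => iota (dK i (k (lift j0 j))))) => [j1|].
    by eexists.
  (* The term at [j0] vanishes because [k j0 = 1] is a constant. *)
  have := operator_relation hext i xC k_rel.
  by rewrite (bigD1_ord j0) //= kj0 (subfield_set1 KF i) rmorph0 mul0r add0r.
have /eqP :=
  x_indep (fun j => iota (k j)) (fun j => imageP iota (kC j)) k_rel j0.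
by rewrite kj0 rmorph1 oner_eq0.
Qed.
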